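(* Let $F$ be a DeMorgan circuit computing a Boolean function $f:\{0,1\}^n\to\{0,1\}$, and let $\alpha\in\{0,\mathfrak u,1\}^n$ be a prime $1$-witness of $f$. The following are equivalent: (1) $F$ has a $1$-hazard at $\alpha$; (2) $c(\alpha)=\mathfrak u$ for some one-clause $c$ produced by $F$; (3) $t_\alpha$ and $c$ share no literal, for some one-clause $c$ produced by $F$; (4) $t(\alpha)\in\{0,\mathfrak u\}$ for every term $t$ produced by $F$; (5) the prime implicant $t_\alpha$ of $f$ is not produced by $F$.
   Context: A DeMorgan circuit has fan-in-2 AND/OR gates and inputs $0,1,x_i,\bar x_i$. Literals: $x_i^1=x_i$, $x_i^0=\bar x_i$; term = AND of literals, clause = OR of literals; a one-clause contains some $x_i$ together with $\bar x_i$. Produced terms: at an input gate, the literal/constant itself; at an OR gate, the union of the sets at its two inputs; at an AND gate, all $t_1\land t_2$ with $t_1,t_2$ produced at the two inputs. Produced clauses: at an input gate, the literal/constant itself; at an AND gate, the union; at an OR gate, all $c_1\lor c_2$. The laws $x\bar x=0$, $x\lor\bar x=1$ are not applied. Ternary logic on $\{0,\mathfrak u,1\}$ ($\mathfrak u=1/2$): AND $=\min$, OR $=\max$, NOT $=1-x$; terms, clauses and circuits are evaluated on ternary vectors accordingly. $S_\alpha$: Boolean vectors obtained from $\alpha$ by replacing each $\mathfrak u$ by $0$ or $1$. $F$ has a $1$-hazard at $\alpha$ if $F(a)=1$ for all $a\in S_\alpha$ but $F(\alpha)=\mathfrak u$. $t_\alpha=\bigwedge_{i:\alpha_i\ne\mathfrak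 u}x_i^{\alpha_i}$; $\alpha$ is a prime $1$-witness of $f$ if $t_\alpha$ is a prime implicant of $f$ ($t_\alpha\le f$ and no proper subterm is $\le f$). *)

(* Defs.v *)
From mathcomp Require Import all_boot all_order all_algebra.
Import Order.TTheory GRing.Theory Num.Theory.

Set Implicit Arguments.
Unset Strict Implicit.
Unset Printing Implicit Defensive.

(* Ternary values: [Some b] is the Boolean constant b, [None] is the
   undecided value u = 1/2. *)
Definition ternary := option bool.
Notation undecided := (@None bool).

Definition tnot (x : ternary) : ternary := omap negb x.

Definition tand (x y : ternary) : ternary :=
  match x, y with
  | Some false, _ | _, Some false => Some false
  | Some true, Some true => Some true
  | _, _ => undecided
  end.

Definition tor (x y : ternary) : ternary :=
  match x, y with
  | Some true, _ | _, Some true => Some true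
  | Some false, Some false => Some false
  | _, _ => undecided
  end.

Section TernaryAsNumbers.
Local Open Scope ring_scope.

Definition ternary_rat (x : ternary) : rat :=
  if x is Some b then b%:R else 1 / 2%:R.

Lemma ternary_ratN x : ternary_rat (tnot x) = 1 - ternary_rat x.
Proof. by case: x => [[]|]; apply/eqP. Qed.

Lemma ternary_rat_and x y :
  ternary_rat (tand x y) = Num.min (ternary_rat x) (ternary_rat y).
Proof. by case: x => [[]|]; case: y => [[]|]; apply/eqP. Qed.

Lemma ternary_rat_or x y :
  ternary_rat (tor x y) = Num.max (ternary_rat x) (ternary_rat y).
Proof. by case: x => [[]|]; case: y => [[]|]; apply/eqP. Qed.

End TernaryAsNumbers.

(* Coordinates are numbered from 0.  The literal [(i, true)] is x_i and
   [(i, false)] is its negation. *)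
Definition literal (n : nat) : finType := ('I_n * bool)%type.

Definition bvec (n : nat) : finType := {ffun 'I_n -> bool}.
Definition tvec (n : nat) : finType := {ffun 'I_n -> ternary}.

Definition literal_bval n (a : bvec n) (l : literal n) : bool :=
  if l.2 then a l.1 else ~~ a l.1.

Definition literal_tval n (alpha : tvec n) (l : literal n) : ternary :=
  if l.2 then alpha l.1 else tnot (alpha l.1).

Inductive input (n : nat) := Const of bool | Lit of literal n.
Arguments Const {n} b.

(* A gate that may read the outputs of m previously listed gates. *)
Inductive gate (n m : nat) :=
  | Input of input n
  | And of 'I_m & 'I_m
  | Or of 'I_m & 'I_m.

(* The gates of a circuit, listed in a topological order; each gate may be
   read by any number of later ones. *)
Inductive gates (n : nat) : nat -> Type :=
  | NoGate : gates n 0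
  | AddGate m : gates n m -> gate n m -> gates n m.+1.

Record circuit (n : nat) := Circuit {
  circuit_size : nat;
  circuit_gates : gates n circuit_size;
  circuit_output : 'I_circuit_size
}.

(* The gate-by-gate recursion shared by evaluation and by the production of
   terms and of clauses. *)
Section Interpretation.
Variables (n : nat) (T : Type) (inp : input n -> T) (conj disj : T -> T -> T).

Definition gate_interp m (v : m.-tuple T) (g : gate n m) : T :=
  match g with
  | Input z => inp z
  | And i j => conj (tnth v i) (tnth v j)
  | Or i j => disj (tnth v i) (tnth v j)
  end.

Fixpoint gates_interp m (G : gates n m) : m.-tuple T :=
  match G with
  | NoGate => [tuple]
  | AddGate _ G' g =>
      [tuple of rcons (gates_interp G') (gate_interp (gates_interp G') g)]
  end.

Definition circuit_interp (F : circuit n) : T :=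
  tnth (gates_interp (circuit_gates F)) (circuit_output F).

End Interpretation.

Definition circuit_bval n (F : circuit n) (a : bvec n) : bool :=
  circuit_interp
    (fun z => match z with Const b => b | Lit l => literal_bval a l end)
    andb orb F.

Definition circuit_tval n (F : circuit n) (alpha : tvec n) : ternary :=
  circuit_interp
    (fun z => match z with Const b => Some b | Lit l => literal_tval alpha l end)
    tand tor F.

Definition computes n (F : circuit n) (f : bvec n -> bool) : Prop :=
  forall a, circuit_bval F a = f a.

(* [Some A] is the conjunction of the literals in A, so that [Some set0] is
   the constant 1; [None] is the constant 0.  A set A may contain both x_i and
   its negation.  Conjunction is taken up to associativity, commutativity,
   idempotence and the laws 1 t = t and 0 t = 0 for constants. *)
Definition term (n : nat) : finType := option {set literal n}.

Definition term_of_input n (z : input n) : term n :=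
  match z with
  | Const b => if b then Some set0 else None
  | Lit l => Some [set l]
  end.

Definition term_and n (t1 t2 : term n) : term n :=
  if (t1, t2) is (Some A1, Some A2) then Some (A1 :|: A2) else None.

Definition term_tval n (alpha : tvec n) (t : term n) : ternary :=
  if t is Some A then \big[tand/Some true]_(l in A) literal_tval alpha l
  else Some false.

(* Dually, [Some A] is the disjunction of the literals in A, so that
   [Some set0] is the constant 0; [None] is the constant 1.  The laws
   0 \/ c = c and 1 \/ c = 1 are applied. *)
Definition clause (n : nat) : finType := option {set literal n}.

Definition clause_of_input n (z : input n) : clause n :=
  match z with
  | Const b => if b then None else Some set0
  | Lit l => Some [set l]
  end.

Definition clause_or n (c1 c2 : clause n) : clause n :=
  if (c1, c2) is (Some A1, Some A2) then Some (A1 :|: A2) else None.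

Definition clause_tval n (alpha : tvec n) (c : clause n) : ternary :=
  if c is Some A then \big[tor/Some false]_(l in A) literal_tval alpha l
  else Some true.

Definition produced_terms n (F : circuit n) : {set term n} :=
  circuit_interp (fun z => [set term_of_input z])
    (fun T1 T2 => [set term_and t1 t2 | t1 in T1, t2 in T2])
    (fun T1 T2 => T1 :|: T2) F.

Definition produced_clauses n (F : circuit n) : {set clause n} :=
  circuit_interp (fun z => [set clause_of_input z])
    (fun C1 C2 => C1 :|: C2)
    (fun C1 C2 => [set clause_or c1 c2 | c1 in C1, c2 in C2]) F.

Definition literals n (e : option {set literal n}) : {set literal n} :=
  if e is Some A then A else set0.

Definition one_clause n (c : clause n) : Prop :=
  exists i : 'I_n, (i, true) \in literals c /\ (i, false) \in literals c.

Definition resolutions n (alpha : tvec n) : {set bvec n} :=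
  [set a : bvec n |
    [forall i, (alpha i == undecided) || (alpha i == Some (a i))]].

Definition has_1hazard n (F : circuit n) (alpha : tvec n) : Prop :=
  (forall a, a \in resolutions alpha -> circuit_bval F a = true) /\
  circuit_tval F alpha = undecided.

(* The conjunction of the literals in A is below f. *)
Definition implicant n (f : bvec n -> bool) (A : {set literal n}) : Prop :=
  forall a : bvec n, (forall l, l \in A -> literal_bval a l) -> f a.

Definition prime_implicant n (f : bvec n -> bool) (A : {set literal n}) : Prop :=
  implicant f A /\ forall B : {set literal n}, B \proper A -> ~ implicant f B.

(* The literals of t_alpha. *)
Definition witness_literals n (alpha : tvec n) : {set literal n} :=
  [set l : literal n | alpha l.1 == Some l.2].

Definition witness_term n (alpha : tvec n) : term n :=
  Some (witness_literals alpha).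

Definition prime_1witness n (f : bvec n -> bool) (alpha : tvec n) : Prop :=
  prime_implicant f (witness_literals alpha).

(* Main.v *)
Require Import Defs.
From mathcomp Require Import all_boot all_order all_algebra.

Set Implicit Arguments.
Unset Strict Implicit.
Unset Printing Implicit Defensive.

(** At every ternary vector the circuit has value 1 iff some produced term has
    value 1, iff all produced clauses have value 1.  At a prime 1-witness alpha
    the circuit never has value 0, so there is a hazard iff its value is not 1.
    A produced term of value 1 at alpha is an implicant of f contained in
    t_alpha, hence equals t_alpha by primality.  A produced clause that is not 1
    at alpha contains some x_i and its negation, since otherwise the undecided
    coordinates could be set so as to falsify the clause, and with it f, on a
    vector of S_alpha. *)

(** * Comparing two interpretations of a circuit *)

Section CircuitRelation.
Variables (n : nat) (T1 T2 : Type) (R : T1 -> T2 -> Prop).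
Variables (inp1 : input n -> T1) (conj1 disj1 : T1 -> T1 -> T1).
Variables (inp2 : input n -> T2) (conj2 disj2 : T2 -> T2 -> T2).
Hypothesis Rinp : forall z, R (inp1 z) (inp2 z).
Hypothesis Rconj : forall x1 x2 y1 y2,
  R x1 x2 -> R y1 y2 -> R (conj1 x1 y1) (conj2 x2 y2).
Hypothesis Rdisj : forall x1 x2 y1 y2,
  R x1 x2 -> R y1 y2 -> R (disj1 x1 y1) (disj2 x2 y2).

(** Logical-relation principle: the one induction over gates. Each later comparison of two
    interpretations only has to be checked at inputs, AND and OR. *)
Lemma gates_interp_rel m (G : gates n m) (i : 'I_m) :
  R (tnth (gates_interp inp1 conj1 disj1 G) i)
    (tnth (gates_interp inp2 conj2 disj2 G) i).
Proof.
elim: G i => [[]//|{}m G IH g] i.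
set v1 := gates_interp _ _ _ _ in IH *; set v2 := gates_interp _ _ _ _ in IH *.
have Rg : R (gate_interp inp1 conj1 disj1 v1 g)
            (gate_interp inp2 conj2 disj2 v2 g).
  by case: g => [z|j k|j k] /=; [apply: Rinp|apply: Rconj|apply: Rdisj].
set x1 := gate_interp _ _ _ _ _ in Rg; set x2 := gate_interp _ _ _ _ _ in Rg.
(* The values of the new gate double as [nth] defaults, so [Rg] also settles the impossible
   out-of-range case. *)
rewrite (tnth_nth x1) (tnth_nth x2) /= !nth_rcons !size_tuple.
case: ltngtP => [lt_im|_|_] //.
by have := IH (Ordinal lt_im); rewrite (tnth_nth x1) (tnth_nth x2).
Qed.

Lemma circuit_interp_rel (F : circuit n) :
  R (circuit_interp inp1 conj1 disj1 F) (circuit_interp inp2 conj2 disj2 F).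
Proof. exact: gates_interp_rel. Qed.

End CircuitRelation.

(** * Existential statements over sets of produced terms or clauses *)

Section ExistsIn.
Variables (T : finType) (p : pred T).
Implicit Types A B : {set T}.

Lemma exists_in_set1 x : [exists y in [set x], p y] = p x.
Proof.
by apply/exists_inP/idP => [[_ /set1P->]|px] //; exists x; rewrite ?set11.
Qed.

Lemma exists_in_setU A B :
  [exists x in A :|: B, p x] = [exists x in A, p x] || [exists x in B, p x].
Proof.
apply/exists_inP/orP => [[x /setUP[] xAB px]|[] /exists_inP[x xAB px]].
- by left; apply/exists_inP; exists x.
- by right; apply/exists_inP; exists x.
- by exists x; rewrite // inE xAB.
- by exists x; rewrite // inE xAB orbT.
Qed.

(** Applied to terms having value 1 at an AND gate, and to clauses not having value 1 at an OR
    gate. *)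
Lemma exists_in_imset2 (op : T -> T -> T) A B :
  (forall x y, p (op x y) = p x && p y) ->
  [exists z in [set op x y | x in A, y in B], p z] =
  [exists x in A, p x] && [exists y in B, p y].
Proof.
move=> pop; apply/exists_inP/andP.
  case=> _ /imset2P[x y xA yB ->]; rewrite pop => /andP[px py].
  by split; apply/exists_inP; [exists x | exists y].
case=> /exists_inP[x xA px] /exists_inP[y yB py].
by exists (op x y); [apply: imset2_f | rewrite pop px].
Qed.

End ExistsIn.

Lemma tand_eq1 x y :
  (tand x y == Some true) = (x == Some true) && (y == Some true).
Proof. by case: x y => [[]|] [[]|]. Qed.

Lemma tor_eq1 x y :
  (tor x y == Some true) = (x == Some true) || (y == Some true).
Proof. by case: x y => [[]|] [[]|]. Qed.

Lemma tor_eq0 x y :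
  (tor x y == Some false) = (x == Some false) && (y == Some false).
Proof. by case: x y => [[]|] [[]|]. Qed.

(** * Ternary values of terms, clauses and circuits *)

Section Evaluation.
Variable n : nat.
Implicit Types (F : circuit n) (alpha : tvec n) (a : bvec n).
Implicit Types (t : term n) (c : clause n).

(** Embedding that makes Boolean evaluation a special case of ternary evaluation. *)
Definition tvec_of_bvec a : tvec n := [ffun i => Some (a i)].

Lemma literal_tval_eq1 alpha l :
  (literal_tval alpha l == Some true) = (l \in witness_literals alpha).
Proof.
by case: l => i []; rewrite inE /literal_tval /=; case: (alpha i) => [[]|].
Qed.

Lemma mem_witness_tvec_of_bvec a l :
  (l \in witness_literals (tvec_of_bvec a)) = literal_bval a l.
Proof. by case: l => i []; rewrite inE ffunE /literal_bval /=; case: (a i). Qed.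

(** Testing for value 1 turns [tand] into [andb], and the literals of value 1 at [alpha] are those
    of its witness term. *)
Lemma term_tval_eq1 alpha t :
  (term_tval alpha t == Some true) =
  if t is Some A then A \subset witness_literals alpha else false.
Proof.
case: t => [A|] //=.
rewrite (@big_morph _ _ (fun x => x == Some true) true andb) //;
  last exact: tand_eq1.
rewrite big_andE; apply/forall_inP/subsetP => sub l /sub;
  by rewrite literal_tval_eq1.
Qed.

Lemma clause_tval_eq1 alpha c :
  (clause_tval alpha c == Some true) =
  if c is Some A then ~~ [disjoint witness_literals alpha & A] else true.
Proof.
case: c => [A|] //=.
rewrite (@big_morph _ _ (fun x => x == Some true) false orb) //;
  last exact: tor_eq1.
rewrite big_orE; apply/exists_inP/pred0Pn => [] [l].
  by rewrite literal_tval_eq1 => lA lW; exists l; rewrite /= lW.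
by case/andP=> lW lA; exists l; rewrite ?literal_tval_eq1.
Qed.

(** A variable and its negation are never both 0, even in ternary logic. *)
Lemma one_clause_tval_neq0 alpha c :
  one_clause c -> clause_tval alpha c <> Some false.
Proof.
case: c => [A|] [i [/= iA niA]]; last by rewrite inE in iA.
move/eqP; rewrite (@big_morph _ _ (fun x => x == Some false) true andb) //;
  last exact: tor_eq0.
rewrite big_andE => /forall_inP A0; move: (A0 _ iA) (A0 _ niA).
by rewrite /literal_tval /=; case: (alpha i) => [[]|].
Qed.

Lemma term_tval_and_eq1 alpha t1 t2 :
  (term_tval alpha (term_and t1 t2) == Some true) =
  (term_tval alpha t1 == Some true) && (term_tval alpha t2 == Some true).
Proof.
rewrite !term_tval_eq1; case: t1 t2 => [A1|] [A2|] //=; last by rewrite andbF.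
exact: subUset.
Qed.

Lemma clause_tval_or_neq1 alpha c1 c2 :
  (clause_tval alpha (clause_or c1 c2) != Some true) =
  (clause_tval alpha c1 != Some true) && (clause_tval alpha c2 != Some true).
Proof.
rewrite !clause_tval_eq1; case: c1 c2 => [A1|] [A2|] //=; last by rewrite andbF.
by rewrite !negbK -!setI_eq0 setIUr setU_eq0.
Qed.

Lemma circuit_tval_terms F alpha :
  (circuit_tval F alpha == Some true) =
  [exists t in produced_terms F, term_tval alpha t == Some true].
Proof.
pose R (v : ternary) (Ts : {set term n}) := (v == Some true) =
  [exists t in Ts, term_tval alpha t == Some true].
apply: (@circuit_interp_rel _ _ _ R) => [z|v1 T1 v2 T2 R1 R2|v1 T1 v2 T2 R1 R2].
- rewrite /R exists_in_set1 term_tval_eq1; case: z => [[]|l] /=.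
  + by rewrite sub0set.
  + by [].
  + by rewrite literal_tval_eq1 sub1set.
- rewrite /R tand_eq1 R1 R2 exists_in_imset2 //; exact: term_tval_and_eq1.
- by rewrite /R tor_eq1 R1 R2 exists_in_setU.
Qed.

(** Dual to the lemma on terms. Negating the test for 1 makes it existential again, so the same set
    lemmas apply. *)
Lemma circuit_tval_clauses F alpha :
  (circuit_tval F alpha != Some true) =
  [exists c in produced_clauses F, clause_tval alpha c != Some true].
Proof.
pose R (v : ternary) (Cs : {set clause n}) := (v != Some true) =
  [exists c in Cs, clause_tval alpha c != Some true].
apply: (@circuit_interp_rel _ _ _ R) => [z|v1 C1 v2 C2 R1 R2|v1 C1 v2 C2 R1 R2].
- rewrite /R exists_in_set1 clause_tval_eq1; case: z => [[]|l] /=.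
  + by [].
  + by rewrite negbK -setI_eq0 setI0 eqxx.
  + by rewrite literal_tval_eq1 disjoint_sym disjoints1 negbK.
- by rewrite /R tand_eq1 negb_and R1 R2 exists_in_setU.
- rewrite /R tor_eq1 negb_or R1 R2 exists_in_imset2 //.
  exact: clause_tval_or_neq1.
Qed.

Lemma circuit_tval_of_bvec F a :
  circuit_tval F (tvec_of_bvec a) = Some (circuit_bval F a).
Proof.
apply: (@circuit_interp_rel _ _ _ (fun v b => v = Some b)).
- by case=> // -[i []]; rewrite /literal_tval /literal_bval /= ffunE.
- by move=> _ [] _ [] -> ->.
- by move=> _ [] _ [] -> ->.
Qed.

(** Ternary gates are monotone under refinement: a decided output survives every resolution of the
    undecided inputs. *)
Lemma circuit_tval_resolutions F alpha a b : a \in resolutions alpha ->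
  circuit_tval F alpha = Some b -> circuit_bval F a = b.
Proof.
rewrite inE => /forallP aalpha; move: b.
apply: (@circuit_interp_rel _ _ _
  (fun v w => forall b : bool, v = Some b -> w = b)).
- case=> [b b' [] // | [i s] b]; move: (aalpha i).
  rewrite /literal_tval /literal_bval /=.
  by case: (alpha i) => [x|]; case: s => //= /eqP [->] [].
- move=> v1 w1 v2 w2 R1 R2 b.
  by case: v1 v2 R1 R2 => [[]|] [[]|] //= R1 R2 [<-];
    rewrite ?(R1 _ erefl) ?(R2 _ erefl) ?andbF.
- move=> v1 w1 v2 w2 R1 R2 b.
  by case: v1 v2 R1 R2 => [[]|] [[]|] //= R1 R2 [<-];
    rewrite ?(R1 _ erefl) ?(R2 _ erefl) ?orbT.
Qed.

End Evaluation.

Theorem theorem5 (n : nat) (F : circuit n) (f : bvec n -> bool)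
    (alpha : tvec n) (computesFf : computes F f)
    (alpha_prime : prime_1witness f alpha) :
  [<-> (* 1 *) has_1hazard F alpha;
       (* 2 *) exists c : clause n,
                 [/\ c \in produced_clauses F, one_clause c &
                     clause_tval alpha c = undecided];
       (* 3 *) exists c : clause n,
                 [/\ c \in produced_clauses F, one_clause c &
                     [disjoint literals (witness_term alpha) & literals c]];
       (* 4 *) forall t : term n, t \in produced_terms F ->
                 term_tval alpha t = Some false \/
                 term_tval alpha t = undecided;
       (* 5 *) witness_term alpha \notin produced_terms F].
Proof.
have [alpha_impl alpha_min] := alpha_prime.
(* Every resolution satisfies $t_\alpha\le f$, so a hazard only depends on the ternary value of
   [F]. *)
have F1 a : a \in resolutions alpha -> circuit_bval F a = true.
  rewrite inE => /forallP aalpha; rewrite computesFf.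
  apply: alpha_impl => -[i b]; rewrite inE /= => /eqP ai.
  move: (aalpha i); rewrite ai /literal_bval /= => /eqP[->].
  by case: (a i).
tfae.
- case=> _ Fu.
  have : circuit_tval F alpha != Some true by rewrite Fu.
  rewrite circuit_tval_clauses => /exists_inP[c cF c1].
  have onec : one_clause c.
    move: c1; rewrite clause_tval_eq1; case: c cF => // C CF.
    rewrite negbK => WC.
    have /existsP[i /andP[iC niC]] :
        [exists i, ((i, true) \in C) && ((i, false) \in C)].
      apply: contraT => /existsPn noC.
      (* An undecided $x_i$ becomes 1 exactly when its negation is in [C]. As [C] never contains
         both literals, this falsifies those of [C] at undecided coordinates; [WC] handles the
         decided ones. *)
      pose a : bvec n :=
        [ffun i => if alpha i is Some b then b else (i, false) \in C].
      have aalpha : a \in resolutions alpha.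
        by rewrite inE; apply/forallP => i; rewrite ffunE;
           case: (alpha i) => //= b; rewrite eqxx.
      have : ~~ [exists c in produced_clauses F,
          clause_tval (tvec_of_bvec a) c != Some true].
        by rewrite -circuit_tval_clauses circuit_tval_of_bvec F1.
      rewrite negb_exists_in => /forall_inP/(_ _ CF); rewrite negbK.
      rewrite clause_tval_eq1 => /pred0Pn[[i b] /andP[]] /=.
      rewrite mem_witness_tvec_of_bvec /literal_bval ffunE /= => ab ibC.
      have := disjointFl WC ibC; rewrite inE /=.
      case: (alpha i) ab => [b'|] ab; first by case: b b' ab {ibC} => [] [].
      by move: (noC i) ab ibC; case: b; do 2!case: (_ \in C).
    by exists i.
  exists c; split=> //; case E: (clause_tval alpha c) c1 => [[]|] // _.
  by case: (one_clause_tval_neq0 onec E).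
- case=> c [cF onec cu]; exists c; split=> //.
  move/eqP: cu; case: c cF onec => [C|] // CF onec /eqP cu.
  by have := clause_tval_eq1 alpha (Some C); rewrite cu => /esym/negbFE.
- case=> c [cF onec dis] t tF.
  case E: (term_tval alpha t) => [[]|]; [exfalso|by left|by right].
  have : circuit_tval F alpha == Some true.
    by rewrite circuit_tval_terms; apply/exists_inP; exists t; rewrite ?E.
  apply/negP; rewrite circuit_tval_clauses; apply/exists_inP; exists c => //.
  rewrite clause_tval_eq1; case: c onec dis {cF} => [C _ ->|] //.
  (* The constant clause 1 has no literals and is trivially disjoint from $t_\alpha$; being a
     one-clause excludes it. *)
  by case=> i [/=]; rewrite in_set0.
- move=> T0; apply/negP => /T0.
  have /eqP-> : term_tval alpha (witness_term alpha) == Some true.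
    by rewrite term_tval_eq1 /= subxx.
  by case.
- move=> tF; split=> //.
  case E: (circuit_tval F alpha) => [[]|] //; exfalso.
    move/eqP: E; rewrite circuit_tval_terms => /exists_inP[t].
    rewrite term_tval_eq1; case: t => [A|] // AF AW.
    (* A produced term of value 1 lies inside $t_\alpha$, and properly so since $t_\alpha$ is not
       produced. It is an implicant, against primality. *)
    have AnW : A \proper witness_literals alpha.
      rewrite properEneq AW andbT.
      by apply: contra tF => /eqP; rewrite /witness_term => <-.
    apply: (alpha_min A AnW) => a Aa; rewrite -computesFf.
    suff : circuit_tval F (tvec_of_bvec a) == Some true.
      by rewrite circuit_tval_of_bvec => /eqP[].
    rewrite circuit_tval_terms; apply/exists_inP; exists (Some A) => //.
    rewrite term_tval_eq1; apply/subsetP => l /Aa.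
    by rewrite mem_witness_tvec_of_bvec.
  (* Ternary value 0 would force value 0 at every resolution; any one contradicts [F1]. *)
  pose a : bvec n := [ffun i => odflt false (alpha i)].
  have aalpha : a \in resolutions alpha.
    by rewrite inE; apply/forallP => i; rewrite ffunE;
           case: (alpha i) => //= b; rewrite eqxx.
  by have := circuit_tval_resolutions aalpha E; rewrite F1.
Qed.
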